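(* Let $G=C_{n_1}\oplus C_{n_2}\oplus\cdots\oplus C_{n_r}$ be an abelian group of odd order, where $r\ge 2$ and $2\le n_r\mid\cdots\mid n_2\mid n_1$, such that $1<\ell:=\frac{n_1}{n_2}$, and put $n=n_2$. Let $g_1,g_2,g_3\in G$ be distinct elements with $\operatorname{ord}(g_i)=\ell n$ for $i=1,2,3$. Suppose that $\mathsf{m}=[m_1,m_2,m_3]\in\mathcal{B}(g_1,g_2,g_3)$ is an element such that $\ell n<|\mathsf{m}|$ and exactly one of $m_1,m_2,m_3$ is even. Then $\mathsf{m}$ is not a group atom in $\mathcal{B}(g_1,g_2,g_3)$.
   Context: $C_n$ denotes the cyclic group of order $n$. For elements $g_1,\dots,g_k$ of an additively written finite abelian group $G$, the block monoid is $\mathcal{B}(g_1,\dots,g_k):=\{[m_1,\dots,m_k]\in\mathbb{N}^k:\sum_{i=1}^k m_ig_i=0\in G\}$ (with $0\in\mathbb{N}$), a submonoid of the additive group $\mathbb{Z}^k$. The length of $\mathsf{m}=[m_1,\dots,m_k]\in\mathcal{B}(g_1,\dots,g_k)$ is $|\mathsf{m}|=\sum_{i=1}^k m_i$. An element $\mathsf{m}\in\mathcal{B}(g_1,\dots,g_k)$ is a group atom in $\mathcal{B}(g_1,\dots,g_k)$ if it cannot be written as an integral linear combination (coefficients in $\mathbb{Z}$) of elements of $\mathcal{B}(g_1,\dots,g_k)$ whose length is strictly smaller than $|\mathsf{m}|$. $\operatorname{ord}(g)$ is the order of $g$ in $G$. *)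

(* Defs.v *)
From HB Require Import structures.
From mathcomp Require Import all_boot all_order all_algebra all_fingroup all_solvable.

Set Implicit Arguments.
Unset Strict Implicit.
Unset Printing Implicit Defensive.

Import Order.TTheory GRing.Theory Num.Theory.
Local Open Scope ring_scope.

Definition block_monoid (G : zmodType) (k : nat) (g : 'I_k -> G) :
    {pred 'rV[nat]_k} :=
  [pred m : 'rV[nat]_k | \sum_(i < k) g i *+ m 0 i == 0].

Definition block_length (k : nat) (m : 'rV[nat]_k) : nat :=
  (\sum_(i < k) m 0%R i)%N.

(* The inclusion of N^k in Z^k. *)
Definition Zvec (k : nat) (m : 'rV[nat]_k) : 'rV[int]_k := map_mx Posz m.

(* [inIntSpan s v] is the library's "v is a linear combination of the entries
   of s with coefficients in int", here in 'rV[int]_k. *)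
Definition group_atom (G : zmodType) (k : nat) (g : 'I_k -> G)
    (m : 'rV[nat]_k) : Prop :=
  m \in block_monoid g /\
  ~ exists (p : nat) (s : p.-tuple 'rV[nat]_k),
      (forall u, u \in s ->
         u \in block_monoid g /\ (block_length u < block_length m)%N) /\
      inIntSpan (map_tuple (@Zvec k) s) (Zvec m).

(* G is the (internal) direct sum of cyclic subgroups <e_1>, ..., <e_r> with
   <e_i> of order n_i, i.e. G = C_{n_1} (+) ... (+) C_{n_r}; only the values of
   n at 1, ..., r matter.  A [finZmodType] is canonically a [finGroupType] for
   its addition, which gives meaning to [dprod], [<[_]>] and [#[_]]. *)
Definition sum_of_cyclic (G : finZmodType) (r : nat) (n : nat -> nat) : Prop :=
  exists e : nat -> G,
    (forall i, (1 <= i <= r)%N -> #[e i]%g = n i) /\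
    \big[dprod/1%g]_(1 <= i < r.+1) <[e i]>%g = [set: G].

(* Main.v *)
Require Import Defs.
From HB Require Import structures.
From mathcomp Require Import all_boot all_order all_algebra all_fingroup all_solvable.
From mathcomp Require Import zify ring.

(** Write [N = l n].  Since [n G] is cyclic of order [l] and every [n g_j]
    generates it, [n e_i + n (l - y) e_j] lies in the block monoid for some
    [0 < y < l], and its length is at most [N].  Together with [N e_j] these
    vectors generate every relation among the [g_i] with all coordinates
    divisible by [n].  As [N < |m|], it suffices to find a shorter block [u]
    with [u = m] or [u = - m] modulo [n].

    Write [m = r + n M] with [0 <= r_i < n].  For each [j] some
    [r + n c e_j] with [c < l] is a block, and likewise with [n - r_i] in place
    of [r_i]; their lengths are at most [|r| + N - n] and [3 n - |r| + N - n].
    This settles [|r| <= n] and [2 n <= |r|].  Otherwise [|M| >= l - 1], and the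
    first kind is shorter than [m] unless [c = l - 1] for every [j]; then all
    [n g_j] equal [\sum_i r_i g_i], and [(n - r_i)_i + n (l - 2) e_1] is a block
    of length [N + n - |r| < N]. *)

Set Implicit Arguments.
Unset Strict Implicit.
Unset Printing Implicit Defensive.

Import Order.TTheory GRing.Theory Num.Theory.
Local Open Scope ring_scope.

(** * Evaluation and length of vectors given by their coordinates *)

Lemma mem_block_monoid (G : zmodType) k (g : 'I_k -> G) (f : 'I_k -> nat) :
  (\row_i f i \in block_monoid g) = (\sum_i g i *+ f i == 0).
Proof. by rewrite inE; under eq_bigr do rewrite mxE. Qed.

Lemma block_length_row k (f : 'I_k -> nat) :
  block_length (\row_i f i) = (\sum_i f i)%N.
Proof. by apply: eq_bigr => i _; rewrite mxE. Qed.

Lemma sum_delta (G : zmodType) k (g : 'I_k -> G) (a : nat) (j : 'I_k) :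
  \sum_i g i *+ (a * (i == j)) = g j *+ a.
Proof.
rewrite (bigD1 j) //= eqxx muln1 big1 ?addr0 // => i /negbTE->.
by rewrite muln0 mulr0n.
Qed.

Lemma sumn_delta k (a : nat) (j : 'I_k) : (\sum_(i < k) a * (i == j) = a)%N.
Proof.
rewrite (bigD1 j) //= eqxx muln1 big1 ?addn0 // => i /negbTE->.
by rewrite muln0.
Qed.

Lemma mulmxzE p q (A : 'M[int]_(p, q)) c i j : (A *~ c) i j = A i j * c.
Proof.
rewrite -[RHS]mulrzz; case: c => k; rewrite ?NegzE -?nmulrn -?pmulrn;
  by rewrite ?mxE mulmxnE.
Qed.

(** * Integral combinations of short blocks *)

(** A list of weighted blocks rather than a tuple with a coefficient function, so that adding two
    combinations is concatenation. *)
Definition short_span (G : zmodType) k (g : 'I_k -> G) (L : nat)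
    (v : 'rV[int]_k) : Prop :=
  exists2 t : seq ('rV[nat]_k * int),
    forall x, x \in t -> x.1 \in block_monoid g /\ (block_length x.1 < L)%N
    & v = \sum_(x <- t) Zvec x.1 *~ x.2.

Lemma short_spanD (G : zmodType) k (g : 'I_k -> G) L v w :
  short_span g L v -> short_span g L w -> short_span g L (v + w).
Proof.
move=> [s hs ->] [t ht ->]; exists (s ++ t); last by rewrite big_cat.
by move=> x; rewrite mem_cat => /orP[/hs | /ht].
Qed.

Lemma short_spanMz (G : zmodType) k (g : 'I_k -> G) L v c :
  short_span g L v -> short_span g L (v *~ c).
Proof.
move=> [s hs ->]; exists [seq (x.1, x.2 * c) | x <- s].
  by move=> x /mapP[y ys ->]; exact: (hs y ys).
by rewrite big_map mulrz_suml; apply: eq_bigr => x _; rewrite mulrzA.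
Qed.

Lemma short_span_sum (G : zmodType) k (g : 'I_k -> G) L (I : finType)
    (F : I -> 'rV[int]_k) :
  (forall i, short_span g L (F i)) -> short_span g L (\sum_i F i).
Proof.
move=> hF; apply: big_ind => //; last exact: short_spanD.
by exists [::]; rewrite ?big_nil.
Qed.

Lemma short_span_block (G : zmodType) k (g : 'I_k -> G) L u :
  u \in block_monoid g -> (block_length u < L)%N -> short_span g L (Zvec u).
Proof.
move=> uB uL; exists [:: (u, 1)]; last by rewrite big_seq1 mulr1z.
by move=> x; rewrite inE => /eqP->.
Qed.

Lemma short_span_not_atom (G : zmodType) k (g : 'I_k -> G) m :
  short_span g (block_length m) (Zvec m) -> ~ group_atom g m.
Proof.
move=> [t ht mE] [_]; apply.
exists (size t), (map_tuple fst (in_tuple t)); split.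
  by move=> u /mapP[x xt ->]; apply: ht.
exists [ffun i => (tnth (in_tuple t) i).2].
rewrite mE (big_tnth _ _ t); apply: eq_bigr => i _; rewrite ffunE.
by rewrite -tnth_nth !tnth_map.
Qed.

(** * Relations modulo [n] and the subgroup [n G] *)

(** Subtracting the vectors [w i] with weights [z 0 i] from [z *+ n] leaves a relation supported at
    [j]. Since [g j *+ n] has order [l], this is a multiple of [N], the vector with entry [n * l] at
    [j]. *)
Lemma short_span_scaled (G : zmodType) k (g : 'I_k -> G) (l n L : nat)
    (j : 'I_k) (z : 'rV[int]_k) :
    (l * n < L)%N ->
    (forall a : int, g j *+ n *~ a = 0 -> (l %| a)%Z) ->
    g j *+ n *+ l = 0 ->
    (forall i, exists2 y, (0 < y < l)%N & g i *+ n = g j *+ n *+ y) ->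
    \sum_i g i *+ n *~ z 0 i = 0 ->
  short_span g L (z *+ n).
Proof.
move=> lnL ordl gl hy zK.
pose P i y := (0 < y < l)%N && (g i *+ n == g j *+ n *+ y).
have hP i : exists y, P i y.
  by have [y y1 e] := hy i; exists y; rewrite /P y1 e eqxx.
pose y i := xchoose (hP i).
have yP i : (0 < y i < l)%N /\ g i *+ n = g j *+ n *+ y i.
  by have /andP[? /eqP] := xchooseP (hP i).
pose w i : 'rV[nat]_k := \row_t (n * (t == i) + n * (l - y i) * (t == j))%N.
pose N : 'rV[nat]_k := \row_t (n * l * (t == j))%N.
have wS i : short_span g L (Zvec (w i)).
  have [/andP[y0 yl] ye] := yP i.
  apply: short_span_block; rewrite ?mem_block_monoid ?block_length_row.
    under eq_bigr do rewrite mulrnDr.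
    by rewrite big_split /= !sum_delta ye mulrnA -mulrnDr subnKC ?gl // ltnW.
  (* The length is [n * (1 + (l - y i))], at most [n * l] because [0 < y i]. *)
  rewrite big_split /= !sumn_delta; apply: leq_ltn_trans lnL.
  by rewrite [(l * n)%N]mulnC -[X in (X + _)%N]muln1 -mulnDr leq_mul2l; lia.
have NS : short_span g L (Zvec N).
  apply: short_span_block; rewrite ?mem_block_monoid ?block_length_row.
    by rewrite sum_delta mulrnA gl.
  by rewrite sumn_delta mulnC.
(* Modulo [l] this sum is [- \sum_i z_i y_i], and [\sum_i z_i y_i] times [n g_j] equals
   [\sum_i z_i n g_i = 0]. *)
have /dvdzP[q qE] : (l %| \sum_i z 0 i * (l - y i)%:Z)%Z.
  apply: ordl; rewrite mulrz_sumr.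
  rewrite -[RHS]oppr0 -[in RHS]zK -sumrN; apply: eq_bigr => i _.
  have [/andP[y0 yl] ->] := yP i.
  rewrite mulrC mulrzA -!pmulrn -mulNrz; congr (_ *~ _).
  by rewrite mulrnBr 1?ltnW // gl sub0r.
have -> : z *+ n = \sum_i Zvec (w i) *~ z 0 i + Zvec N *~ - q.
  apply/rowP => t; rewrite mulmxnE.
  rewrite mxE mulmxzE summxE !mxE.
  rewrite (eq_bigr (fun i => z 0 i *+ (n * (i == t))
                     + (n * (t == j))%:Z * (z 0 i * (l - y i)%:Z))); last first.
    move=> i _; rewrite mulmxzE !mxE (eq_sym t i) -mulr_natr natz.
    by rewrite PoszD !PoszM; ring.
  rewrite big_split /= sum_delta -mulr_sumr qE !PoszM; ring.
apply: short_spanD; last exact: short_spanMz.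
by apply: short_span_sum => i; apply: short_spanMz.
Qed.

(** Every [n g_i] is a multiple of [n g_j], so the part of a relation divisible by [n] can be moved
    to coordinate [j] and its coefficient reduced modulo [l]. *)
Lemma residue_completion (G : zmodType) k (g : 'I_k -> G) (l n : nat)
    (r a : 'I_k -> nat) (j : 'I_k) :
    (0 < l)%N -> g j *+ n *+ l = 0 ->
    (forall i, exists y, g i *+ n = g j *+ n *+ y) ->
    \sum_i g i *+ (r i + n * a i) = 0 ->
  exists2 c, (c < l)%N & \row_i (r i + n * c * (i == j))%N \in block_monoid g.
Proof.
move=> l0 gl hy raK.
have [d dE] : exists d, \sum_i g i *+ (n * a i) = g j *+ n *+ d.
  elim/big_ind: _ => [|x y [b ->] [c ->]|i _].
  - by exists 0%N.
  - by exists (b + c)%N; rewrite mulrnDr.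
  have [b bE] := hy i.
  by exists (b * a i)%N; rewrite mulrnA bE -!mulrnA.
exists (d %% l)%N; first by rewrite ltn_mod.
rewrite mem_block_monoid; under eq_bigr do rewrite mulrnDr.
rewrite big_split /= sum_delta mulrnA.
suff <- : g j *+ n *+ d = g j *+ n *+ (d %% l).
  by rewrite -dE -big_split /= -[X in _ == X]raK; under eq_bigr do rewrite -mulrnDr.
by rewrite {1}(divn_eq d l) mulrnDr mulnC mulrnA gl mul0rn add0r.
Qed.

(** For [2 <= i] the order of [e i] divides [n], so [n e_1] generates [n G]. If [x] has the order of
    [e 1], then [n x] has the order of [n e_1] and generates [n G] as well. *)
Lemma sum_of_cyclic_scaled (G : finZmodType) r (ns : nat -> nat) (x y : G) :
    (2 <= r)%N -> sum_of_cyclic G r ns ->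
    (forall i, (1 <= i < r)%N -> ns i.+1 %| ns i)%N ->
    #[x]%g = ns 1%N -> #[y]%g = ns 1%N ->
  exists d, x *+ ns 2 = y *+ ns 2 *+ d.
Proof.
move=> r2 [e [eo eG]] hdvd xo yo; set n := ns 2.
have n2 i : (2 <= i <= r)%N -> (ns i %| n)%N.
  elim: i => // i IH /andP[]; rewrite leq_eqVlt => /orP[/eqP<- // | i2 ir].
  by apply: dvdn_trans (IH _); [apply: hdvd|]; lia.
have in_e1 z : (z ^+ n)%g \in <[e 1%N ^+ n]>%g.
  pose H := [set z : G | (z ^+ n)%g \in <[e 1%N ^+ n]>%g].
  have Hg : group_set H.
    apply/group_setP; split=> [|a b]; first by rewrite inE expg1n group1.
    rewrite !inE expgMn; [exact: groupM|exact: addrC].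
  suff /subsetP/(_ z (in_setT z)) : [set: G] \subset Group Hg by rewrite inE.
  (* [H] is a subgroup, so it is enough that it contains each generator [e i]. *)
  rewrite -(bigdprodWY eG) gen_subG big_nat.
  apply: (big_ind (fun A : {set G} => A \subset Group Hg)) => [|A B sA sB|i ir].
  - by rewrite sub0set.
  - by rewrite subUset sA.
  rewrite cycle_subG inE.
  have [->|i1] := eqVneq i 1%N; first exact: cycle_id.
  have /eqP-> : (e i ^+ n == 1)%g by rewrite -order_dvdn eo ?n2; lia.
  exact: group1.
have n_n1 : (n %| ns 1)%N by apply: hdvd; rewrite r2.
have cyE z : #[z]%g = ns 1%N -> <[z ^+ n]>%g = <[e 1%N ^+ n]>%g.
  move=> zo; apply/eqP; rewrite eqEcard cycle_subG in_e1 /=.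
  by rewrite -!orderE !orderXdiv ?zo ?eo //; lia.
have : (x ^+ n)%g \in <[y ^+ n]>%g by rewrite cyE.
by case/cycleP=> d dE; exists d.
Qed.

(** As [m] and [u] are both relations, so is the difference [z *+ n], to which [short_span_scaled]
    applies. The uses below have [c] equal to [1] or [-1]. *)
Lemma short_span_congruent (G : zmodType) k (g : 'I_k -> G) (l n L : nat)
    (j : 'I_k) (u m : 'rV[nat]_k) (c : int) (z : 'rV[int]_k) :
    (l * n < L)%N ->
    (forall a : int, g j *+ n *~ a = 0 -> (l %| a)%Z) ->
    g j *+ n *+ l = 0 ->
    (forall i, exists2 y, (0 < y < l)%N & g i *+ n = g j *+ n *+ y) ->
    u \in block_monoid g -> (block_length u < L)%N -> m \in block_monoid g ->
    Zvec m = Zvec u *~ c + z *+ n ->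
  short_span g L (Zvec m).
Proof.
move=> lnL ordl gl hy uB uL mB mE; rewrite mE.
apply: short_spanD; first exact/short_spanMz/short_span_block.
apply: (short_span_scaled lnL ordl gl hy).
have sumE (v : 'rV[nat]_k) : v \in block_monoid g -> \sum_i g i *~ Zvec v 0 i = 0.
  by rewrite inE => /eqP v0; rewrite -[RHS]v0; apply: eq_bigr => i _; rewrite mxE.
have := sumE m mB; rewrite mE.
under eq_bigr => i _ do
  rewrite mxE mulmxzE mulmxnE mulrzDr mulrzA -(mulr_natl (z 0 i)) natz mulrzA
    -pmulrn.
by rewrite big_split /= -mulrz_suml sumE // mul0rz add0r.
Qed.

Theorem proposition3p2 (G : finZmodType) (r : nat) (ns : nat -> nat)
    (hr : (2 <= r)%N)
    (hG : sum_of_cyclic G r ns)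
    (hodd : odd #|[set: G]|)
    (hnr : (2 <= ns r)%N)
    (hdvd : forall i : nat, (1 <= i < r)%N -> (ns i.+1 %| ns i)%N)
    (l n : nat)
    (hl : l = (ns 1%N %/ ns 2%N)%N)
    (hl1 : (1 < l)%N)
    (hn : n = ns 2%N)
    (g : 'I_3 -> G)
    (g_inj : injective g)
    (g_ord : forall i : 'I_3, #[g i]%g = (l * n)%N)
    (m : 'rV[nat]_3)
    (hm : m \in block_monoid g)
    (hlen : (l * n < block_length m)%N)
    (heven : #|[set i : 'I_3 | ~~ odd (m 0 i)]| = 1%N) :
  ~ group_atom g m.
Proof.
have ln1 : (l * n = ns 1)%N by rewrite hl hn divnK ?hdvd ?hr.
have n0 : (0 < n)%N by have := order_gt0 (g ord0); rewrite g_ord muln_gt0 => /andP[].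
have l0 : (0 < l)%N by rewrite ltnW.
have gE i k : (g i *+ n *+ k == 0) = (l %| k)%N.
  rewrite -mulrnA -[LHS](order_dvdn (g i)) g_ord [(l * n)%N]mulnC.
  by rewrite dvdn_pmul2l.
have gl i : g i *+ n *+ l = 0 by apply/eqP; rewrite gE.
have ordl i (a : int) : g i *+ n *~ a = 0 -> (l %| a)%Z.
  rewrite dvdzE; case: a => k /eqP.
    by rewrite -pmulrn gE.
  by rewrite NegzE -nmulrn oppr_eq0 gE abszN.
have hy i j : exists2 y, (0 < y < l)%N & g i *+ n = g j *+ n *+ y.
  have [d] : exists d, g i *+ n = g j *+ n *+ d.
    by rewrite hn; apply: sum_of_cyclic_scaled hr hG hdvd _ _; rewrite g_ord.
  rewrite {1}(divn_eq d l) mulrnDr mulnC mulrnA gl mul0rn add0r => dE.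
  exists (d %% l)%N => //; rewrite ltn_mod l0 andbT lt0n.
  (* A zero residue would give [n g_i = 0], but [n g_i] has order [l > 1]. *)
  apply/eqP => d0; have := gE i 1%N; rewrite dE d0 !mulr0n eqxx.
  by rewrite dvdn1; lia.
have hy' j i : exists y, g i *+ n = g j *+ n *+ y.
  by have [y _ ->] := hy i j; exists y.
pose rs i := (m 0%R i %% n)%N; pose M i := (m 0%R i %/ n)%N.
have rlt i : (rs i < n)%N by rewrite ltn_mod.
have mE i : m 0 i = (M i * n + rs i)%N by apply: divn_eq.
have LE : block_length m = (\sum_i rs i + n * \sum_i M i)%N.
  rewrite /block_length big_distrr -big_split /=.
  by apply: eq_bigr => i _; rewrite mE; lia.
have mK : \sum_i g i *+ (rs i + n * M i) = 0.
  move: hm; rewrite inE => /eqP m0; rewrite -[RHS]m0; apply: eq_bigr => i _.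
  by rewrite mE addnC mulnC.
(* The coefficient equals [l n (1 + M_i) - m_i], a nonnegative representative of [- m_i] modulo
   [l n]. *)
have mK' : \sum_i g i *+ (n - rs i + n * (l.-1 * (1 + M i))) = 0.
  transitivity (\sum_i (g i *+ n *+ l *+ (1 + M i) - g i *+ (rs i + n * M i))).
    apply: eq_bigr => i _; rewrite -!mulrnA -mulrnBr; last by have := rlt i; nia.
    by congr (_ *+ _); have := rlt i; nia.
  by rewrite big_split /= sumrN mK subr0 big1 // => i _; rewrite gl mul0rn.
have atomP u c z := fun uB uL mz => short_span_not_atom
  (@short_span_congruent _ _ g l n _ ord0 u m c z hlen
    (@ordl ord0) (gl ord0) (hy^~ ord0) uB uL hm mz).
have pos_case (f : 'I_3 -> nat) :
    \row_i (rs i + n * f i)%N \in block_monoid g ->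
    (\sum_i (rs i + n * f i) < block_length m)%N -> ~ group_atom g m.
  move=> fB fL.
  apply: (@atomP (\row_i (rs i + n * f i)%N) 1
    (\row_i (Posz (M i) - Posz (f i)))) => //.
    by rewrite block_length_row.
  apply/rowP => i; rewrite !(mulmxzE, mulmxnE, mxE) mE.
  by rewrite -mulr_natr natz; lia.
have neg_case (f : 'I_3 -> nat) :
    \row_i (n - rs i + n * f i)%N \in block_monoid g ->
    (\sum_i (n - rs i + n * f i) < block_length m)%N -> ~ group_atom g m.
  move=> fB fL.
  apply: (@atomP (\row_i (n - rs i + n * f i)%N) (-1)
    (\row_i (Posz (M i) + 1 + Posz (f i)))) => //.
    by rewrite block_length_row.
  apply/rowP => i; rewrite !(mulmxzE, mulmxnE, mxE) mE.
  by rewrite -mulr_natr natz; have := rlt i; lia.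
(* A zero residue is complemented to [n], not to [0], so the total is always exactly [3 n]. *)
have sumr' : (\sum_i (n - rs i) + \sum_i rs i = 3 * n)%N.
  rewrite -big_split /= (eq_bigr (fun=> n)) ?sum_nat_const ?card_ord // => i _.
  by rewrite subnK // ltnW.
have sum_shift (f : 'I_3 -> nat) c j :
    (\sum_i (f i + n * (c * (i == j))) = \sum_i f i + n * c)%N.
  by rewrite big_split /= -big_distrr /= sumn_delta.
have compl (f a : 'I_3 -> nat) j : \sum_i g i *+ (f i + n * a i) = 0 ->
    exists2 c, (c < l)%N & \row_i (f i + n * (c * (i == j)))%N \in block_monoid g.
  move=> /(residue_completion l0 (gl j) (hy' j))[c cl cB]; exists c => //.
  by rewrite !mem_block_monoid in cB *; under eq_bigr do rewrite mulnA.
have [s_le|s_gt] := leqP (\sum_i rs i) n.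
  have [c cl /pos_case] := compl _ _ ord0 mK; apply; rewrite sum_shift; nia.
have [s_ge|s_lt] := leqP (2 * n) (\sum_i rs i).
  have [c cl /neg_case] := compl _ _ ord0 mK'; apply; rewrite sum_shift; nia.
(* From [l n < |r| + n |M|] and [|r| < 2 n] follows [l - 2 < |M|]. *)
have M_ge : (l.-1 <= \sum_i M i)%N by nia.
have [/forallP all_max|/forallPn[j nmax]] := boolP
    [forall j, \row_i (rs i + n * (l.-1 * (i == j)))%N \in block_monoid g]; last first.
  (* Here [c] differs from [l - 1], hence [c < l - 1 <= |M|] and the completed block is shorter than
     [m]. *)
  have [c cl cB] := compl _ _ j mK; apply: (pos_case _ cB).
  rewrite sum_shift LE ltn_add2l ltn_pmul2l //; apply: leq_trans M_ge.
  suff : c != l.-1 by lia.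
  by apply: contraNneq nmax => <-.
have rsE j : g j *+ n = \sum_i g i *+ rs i.
  have := all_max j; rewrite mem_block_monoid.
  under eq_bigr do rewrite mulrnDr mulnA.
  (* After adding [n (l - 1) g_j] both sides vanish: one is [l n g_j], the other the block given by
     [all_max]. *)
  rewrite big_split /= sum_delta => /eqP h; apply: (addIr (g j *+ (n * l.-1))).
  by rewrite h -mulrnDr -mulnS prednK // mulrnA gl.
apply: (@neg_case (fun i => l.-2 * (i == ord0))%N).
  rewrite mem_block_monoid.
  under eq_bigr do rewrite mulrnDr mulnA mulrnBr 1?ltnW // rsE.
  (* With [S] the common value of the [n g_j], the sum is [3 S - S + (l - 2) S = l S = 0]. *)
  rewrite big_split /= sum_delta mulrnA rsE sumrB sumr_const card_ord.
  rewrite addrAC -mulrnDr; have -> : (3 + l.-2 = l.+1)%N by lia.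
  by rewrite mulrSr addrK -(rsE ord0) gl.
rewrite sum_shift; nia.
Qed.
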